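(* For each $k\in\mathbb{N}\cup\{\infty\}$, there exists a submonoid $M$ of $(\mathbb{Z}^2,+)$ such that $M$ is a Furstenberg monoid, $M$ is not atomic, and $|\mathcal{A}(M)|=k$ (where $|\mathcal{A}(M)|=\infty$ means that $\mathcal{A}(M)$ is infinite).
   Context: $\mathbb{N}=\{1,2,3,\dots\}$. Let $M$ be a submonoid of $(\mathbb{Z}^2,+)$. $\mathcal{U}(M)$ denotes the group of invertible elements of $M$. An element $a\in M\setminus\mathcal{U}(M)$ is an atom if whenever $a=r+s$ with $r,s\in M$, either $r\in\mathcal{U}(M)$ or $s\in\mathcal{U}(M)$; $\mathcal{A}(M)$ is the set of atoms of $M$. $M$ is atomic if every element of $M\setminus\mathcal{U}(M)$ is a finite sum of atoms. For $r,s\in M$, $s$ divides $r$ in $M$ if $r=s+t$ for some $t\in M$. $M$ is a Furstenberg monoid if every element of $M\setminus\mathcal{U}(M)$ is divisible in $M$ by an atom of $M$. *)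

(* Defs.v *)
From mathcomp Require Import all_boot all_order all_algebra.
From mathcomp Require Import classical_sets cardinality.

Set Implicit Arguments.
Unset Strict Implicit.
Unset Printing Implicit Defensive.

Import GRing.Theory.
Local Open Scope classical_set_scope.
Local Open Scope card_scope.
Local Open Scope ring_scope.

Section Submonoids.
Variable V : nmodType.
Implicit Types (M : set V) (x r s : V).

(* [nmod_closed] is stated for boolean predicates; [mem M] is the one attached
   to the classical set [M], so this says that [M] contains 0 and is closed
   under [+]. *)
Definition submonoid M : Prop := Algebra.nmod_closed (mem M).

Definition invertibles M : set V :=
  [set x | M x /\ exists2 y, M y & x + y = 0].

Definition atoms M : set V :=
  [set a | (M `\` invertibles M) a /\
    forall r s, M r -> M s -> a = r + s -> invertibles M r \/ invertibles M s].

(* The empty sum is harmless: it equals 0, which is invertible in a submonoid. *)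
Definition atomic M : Prop :=
  forall x, (M `\` invertibles M) x ->
    exists2 l : seq V, (forall a, a \in l -> atoms M a) & x = \sum_(a <- l) a.

(* [s] divides [r] in [M]; used for [r] and [s] in [M]. *)
Definition divides_in M s r : Prop := exists2 t, M t & r = s + t.

Definition furstenberg M : Prop :=
  forall x, (M `\` invertibles M) x ->
    exists2 a, atoms M a & divides_in M a x.

End Submonoids.

(* Elements of N U {oo} are encoded in [option nat], with [None] for oo. *)
Definition has_card (T : Type) (A : set T) (k : option nat) : Prop :=
  if k is Some n then A #= `I_n else infinite_set A.

(* Main.v *)
Require Import Defs.
From mathcomp Require Import all_boot all_order all_algebra.
From mathcomp Require Import classical_sets cardinality.
From mathcomp Require Import boolp realalg ring lra zify.

(** The finite and the infinite cardinalities are realised by two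
    constructions; both monoids have [0] as their only invertible element.

    For a finite [k >= 1], take the elements of the lexicographic cone of
    [Z^2] whose first coordinate is positive, and on the axis [x = 0] keep only
    the numerical monoid [{0} U {k, k+1, ...}], which has exactly the [k] atoms
    [k, ..., 2k-1]. An element off the axis remains off the axis after
    subtracting [(0, k)], so it is divisible by the atom [(0, k)] and is never
    an atom itself; all the atoms thus lie on the axis, and no element off the
    axis is a sum of atoms.

    For [k = oo], embed [Z^2] in the real line by [v(p, q) = p - q sqrt 2] and
    take [0], all the points with [v > 1], and the points with [v > 0] and
    [q >= 0]. The part of [v <= 1] lies in the wedge [q >= 0, p > sqrt 2 q], where
    [p] is a positive integer that drops whenever an element is split, so
    descent finds an atom dividing any nonzero element there. The wedge has an
    irrational edge, hence elements of arbitrarily small value: powers of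
    [3 - 2 sqrt 2]. So there are atoms of arbitrarily small value, thus
    infinitely many of them, and any point with [v > 1] stays there after
    subtracting a small enough atom. Therefore no atom has [v > 1], all the
    atoms satisfy [q >= 0], and [(0, -1)], whose value is [sqrt 2 > 1], is not a
    sum of atoms. *)

Set Implicit Arguments.
Unset Strict Implicit.
Unset Printing Implicit Defensive.

Import Order.TTheory GRing.Theory Num.Theory.
Local Open Scope classical_set_scope.
Local Open Scope ring_scope.

(** * Reduced monoids and failure of atomicity *)

Section Reduced.
Variable V : nmodType.
Implicit Types (M N : set V) (x y : V).

Lemma submonoidP M :
  submonoid M <-> M 0 /\ (forall x y, M x -> M y -> M (x + y)).
Proof.
split=> -[M0 MD]; split.
- by move: M0; rewrite inE.
- by move=> x y Mx My; have := MD x y; rewrite !inE; apply.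
- by rewrite inE.
- by move=> x y; rewrite !inE; apply: MD.
Qed.

Definition reduced M : Prop :=
  forall x y, M x -> M y -> x + y = 0 -> x = 0.

Lemma reduced_invertibles M : submonoid M -> reduced M ->
  invertibles M = [set 0].
Proof.
move=> /submonoidP [M0 _] redM; apply/seteqP; split=> x /=.
  by case=> Mx [y My] /(redM _ _ Mx My).
by move=> ->; split=> //; exists 0; rewrite ?addr0.
Qed.

Lemma reduced_atoms M a : submonoid M -> reduced M ->
  atoms M a <-> [/\ M a, a <> 0 &
    forall r s, M r -> M s -> a = r + s -> r = 0 \/ s = 0].
Proof.
move=> subM redM; rewrite /atoms /= reduced_invertibles //=.
by split=> [[[Ma a0] aP]|[Ma a0 aP]].
Qed.

(** Sums of atoms never leave a submonoid containing all the atoms. *)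
Lemma not_atomic_atoms_sub M N x : submonoid N -> atoms M `<=` N ->
  (M `\` invertibles M) x -> ~ N x -> ~ atomic M.
Proof.
move=> /submonoidP [N0 ND] atN Mx Nx /(_ x Mx) [l lat xE]; apply: Nx.
rewrite xE big_seq; elim/big_ind: _ => // a al.
exact/atN/lat.
Qed.

Lemma divides_in_addr M a r s : submonoid M ->
  divides_in M a r -> M s -> divides_in M a (r + s).
Proof.
move=> /submonoidP [_ MD] [t Mt ->] Ms.
by exists (t + s); rewrite ?addrA //; apply: MD.
Qed.

End Reduced.

(** * Finitely many atoms: a lexicographic cone *)

Section LexCone.
Variable n : nat.
Hypothesis n_gt0 : (0 < n)%N.

Definition lexcone : set (int * int) :=
  [set x | 0 < x.1 \/ x.1 = 0 /\ (x.2 = 0 \/ n%:Z <= x.2)].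

Lemma lexcone_submonoid : submonoid lexcone.
Proof.
apply/submonoidP; rewrite /lexcone; split=> /=; first by right; split; [|left].
move=> [a b] [c d] /=; lia.
Qed.

Lemma lexcone_reduced : reduced lexcone.
Proof.
rewrite /lexcone => -[a b] [c d] /= Mx My [e1 e2].
by congr pair; lia.
Qed.

Lemma lexcone_atomsE :
  atoms lexcone = [set (0, (n + i)%N%:Z) | i in `I_n].
Proof.
apply/seteqP; split=> -[a b] /=.
  move=> /(reduced_atoms _ lexcone_submonoid lexcone_reduced) [Ma a0 aP].
  (* Subtracting (0, n) would split any element not listed. *)
  have nab : ~ (lexcone (a, b - n%:Z)) \/ (a, b - n%:Z) = 0.
    have [Mab|] := pselect (lexcone (a, b - n%:Z)); last by left.
    right; have := aP (0, n%:Z) (a, b - n%:Z).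
    case=> //; first by rewrite /lexcone /=; lia.
    - by rewrite /GRing.add /= /add_pair /=; congr pair; lia.
    - by case; lia.
  have ab0 : a <> 0 \/ b <> 0.
    have [a00|] := eqVneq a 0; last by move/eqP; left.
    by right=> b0; apply: a0; rewrite a00 b0.
  have [a00 [bn bn2]] : a = 0 /\ n%:Z <= b /\ b < n%:Z + n%:Z.
    move: Ma; case: nab => [|[]]; rewrite /lexcone /=; lia.
  exists (`|b| - n)%N; first by lia.
  by rewrite a00; congr pair; lia.
move=> [i ilt [<- <-]].
apply/(reduced_atoms _ lexcone_submonoid lexcone_reduced); split.
- by rewrite /lexcone /=; lia.
- by case; lia.
- move=> [r1 r2] [s1 s2]; rewrite /lexcone /= => Mr Ms [e1 e2].
  have [r0|r0] : (r1 = 0 /\ r2 = 0) \/ (s1 = 0 /\ s2 = 0) by lia.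
    by left; case: r0 => -> ->.
  by right; case: r0 => -> ->.
Qed.

Lemma lexcone_atoms_card : has_card (atoms lexcone) (Some n).
Proof.
rewrite /has_card lexcone_atomsE; apply: inj_card_eq => i j _ _ [].
lia.
Qed.

Lemma lexcone_furstenberg : furstenberg lexcone.
Proof.
have Mn : lexcone (0, n%:Z) by rewrite /lexcone /=; lia.
move=> x; rewrite reduced_invertibles;
  [|exact: lexcone_submonoid|exact: lexcone_reduced].
case: x => a b [Mx x0]; have [a0|a0] := eqVneq a 0; last first.
  exists (0, n%:Z); first by rewrite lexcone_atomsE; exists 0%N; rewrite ?addn0.
  exists (a, b - n%:Z); first by move: Mx; rewrite /lexcone /=; lia.
  by rewrite /GRing.add /= /add_pair /=; congr pair; lia.
have b0 : b <> 0 by move=> b0; apply: x0; rewrite a0 b0.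
have nb : n%:Z <= b by move: Mx; rewrite /lexcone /=; lia.
have [bn|bn] := ltP b (n%:Z + n%:Z).
  exists (a, b); first rewrite lexcone_atomsE.
    by exists (`|b| - n)%N; [rewrite /=; lia | rewrite a0; congr pair; lia].
  by exists 0; [case/submonoidP: lexcone_submonoid | rewrite addr0].
exists (0, n%:Z); first by rewrite lexcone_atomsE; exists 0%N; rewrite ?addn0.
exists (a, b - n%:Z); first by rewrite /lexcone /=; lia.
by rewrite /GRing.add /= /add_pair /=; congr pair; lia.
Qed.

Lemma lexcone_not_atomic : ~ atomic lexcone.
Proof.
apply: (@not_atomic_atoms_sub _ _ [set x | x.1 = 0] (1, 0)).
- apply/submonoidP; split=> // -[a b] [c d] /= -> ->.
  by rewrite addr0.
- by rewrite lexcone_atomsE => _ [i _ <-].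
- rewrite reduced_invertibles;
    [|exact: lexcone_submonoid|exact: lexcone_reduced].
  by split=> //; left.
- by [].
Qed.

End LexCone.

(** * Infinitely many atoms: a wedge with an irrational edge *)

Lemma seq_lower_bound (R : realFieldType) (T : eqType) (f : T -> R)
    (s : seq T) : (forall a, a \in s -> 0 < f a) ->
  exists2 e, 0 < e & forall a, a \in s -> e <= f a.
Proof.
elim: s => [_|b s IHs fpos]; first by exists 1.
have [a sa|e e0 eP] := IHs; first by apply: fpos; rewrite inE sa orbT.
exists (Num.min e (f b)); first by rewrite lt_min e0 fpos ?mem_head.
move=> a; rewrite inE ge_min => /predU1P [->|/eP->//].
by rewrite lexx orbT.
Qed.

Section Wedge.
Variable R : archiRcfType.
Implicit Types (x y a : int * int) (e : R).

Definition value x : R := x.1%:~R - x.2%:~R * Num.sqrt 2.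

Lemma value0 : value 0 = 0.
Proof. by rewrite /value mul0r subr0. Qed.

Lemma valueD x y : value (x + y) = value x + value y.
Proof. by rewrite /value /= !rmorphD /=; ring. Qed.

Lemma sqrt2_sqr : Num.sqrt 2 * Num.sqrt 2 = 2 :> R.
Proof. by rewrite -expr2 sqr_sqrtr // ler0n. Qed.

(** The lower bound [5/4] is what makes [3 - 2 sqrt 2] at most [1/2], so that its
    powers can be compared with those of [1/2]. *)
Lemma sqrt2_bounds : 5 / 4 < Num.sqrt 2 :> R /\ Num.sqrt 2 < 3 / 2 :> R.
Proof.
have s2 := sqrt2_sqr; have s0 : 0 <= Num.sqrt 2 :> R by apply: sqrtr_ge0.
by split; rewrite ltNge; apply/negP => s_le; nra.
Qed.

(** The witnesses are the coordinates of the powers of [3 - 2 sqrt 2]; since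
    [(p - q sqrt 2) (3 - 2 sqrt 2) = (3p + 4q) - (2p + 3q) sqrt 2], they stay in
    the quadrant [p, q >= 0] while their value is at least halved each time. *)
Lemma small_wedge_element e : 0 < e ->
  exists2 x, 0 <= x.2 & 0 < value x < e.
Proof.
move=> e0; have [lb ub] := sqrt2_bounds; have s2 := sqrt2_sqr.
suff [x [x1 x2 x0 xe]] : exists x,
    [/\ 0 <= x.1, 0 <= x.2, 0 < value x & value x <= 2 ^- Num.bound e^-1].
  by exists x => //; rewrite x0; apply: le_lt_trans xe (upper_nthrootVP e0 _).
elim: (Num.bound _) => [|m [[p q] [/= p0 q0 v0 vm]]].
  by exists (1, 0); split=> //; rewrite /value /= mul0r subr0 ?expr0 ?invr1.
exists (3 * p + 4 * q, 2 * p + 3 * q).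
have -> : value (3 * p + 4 * q, 2 * p + 3 * q)
          = (3 - 2 * Num.sqrt 2) * value (p, q).
  rewrite /value /= !rmorphD !rmorphM /=.
  by ring: s2.
split=> /=; [lia | lia | by apply: mulr_gt0 => //; lra |].
rewrite exprS invfM; apply: ler_pM => //; [lra | exact: ltW | lra].
Qed.

Definition wedge : set (int * int) :=
  [set x | x = 0 \/ 1 < value x \/ 0 < value x /\ 0 <= x.2].

Lemma wedge_value_gt0 x : wedge x -> x <> 0 -> 0 < value x.
Proof. by case=> [//|[x1|[x0 _]]] _ //; apply: lt_trans x1. Qed.

Lemma wedge_value_ge0 x : wedge x -> 0 <= value x.
Proof.
move=> Mx; have [->|/eqP x0] := eqVneq x 0; first by rewrite value0.
exact/ltW/wedge_value_gt0.
Qed.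

Lemma wedge_submonoid : submonoid wedge.
Proof.
apply/submonoidP; split=> [|x y Mx My]; first by left.
have [x0 y0] := (wedge_value_ge0 Mx, wedge_value_ge0 My).
case: Mx => [->|Mx]; first by rewrite add0r.
case: My => [->|My]; first by rewrite addr0; right.
right; rewrite valueD.
case: Mx => [x1|[x1 x2]]; first by left; lra.
case: My => [y1|[y1 y2]]; first by left; lra.
by right; split; [lra | apply: addr_ge0].
Qed.

Lemma wedge_reduced : reduced wedge.
Proof.
move=> x y Mx My xy0; apply: contrapT => /(wedge_value_gt0 Mx) x0.
have y0 := wedge_value_ge0 My; have := valueD x y.
by rewrite xy0 value0; lra.
Qed.

(** Below value [1] the first coordinate of a nonzero element is positive,
    which makes a descent on it possible although values accumulate at [0]. *)
Lemma wedge_fst_gt0 x : wedge x -> x <> 0 -> value x <= 1 ->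
  0 < x.1 /\ 0 <= x.2.
Proof.
case=> [//|[x1|[x0 x2]] _ x1']; first by move: x1; rewrite ltNge x1'.
split=> //; have [lb _] := sqrt2_bounds.
have x2R : 0 <= x.2%:~R :> R by rewrite ler0z.
rewrite -(ltr0z R); move: x0; rewrite /value; nra.
Qed.

Lemma wedge_atom_dvd_small x : wedge x -> x <> 0 -> value x <= 1 ->
  exists2 a, atoms wedge a & divides_in wedge a x.
Proof.
have [m] := ubnP `|x.1|%N; elim: m x => // m IHm x xm Mx x0 x1.
have [atx|natx] := pselect (atoms wedge x).
  by exists x => //; exists 0; [left | rewrite addr0].
have [r [s [[Mr Ms xE] [r0 s0]]]] : exists r s,
    [/\ wedge r, wedge s & x = r + s] /\ r <> 0 /\ s <> 0.
  apply: contrapT => nrs; apply: natx.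
  apply/(reduced_atoms _ wedge_submonoid wedge_reduced); split=> // r s Mr Ms xE.
  apply: contrapT => /not_orP [r0 s0]; apply: nrs.
  by exists r, s.
have [vr vs] := (wedge_value_gt0 Mr r0, wedge_value_gt0 Ms s0).
have vE := valueD r s; rewrite -xE in vE.
have r1 : value r <= 1 by lra.
have s1 : value s <= 1 by lra.
have [rp _] := wedge_fst_gt0 Mr r0 r1.
have [sp _] := wedge_fst_gt0 Ms s0 s1.
have [|a ata adr] := IHm r _ Mr r0 r1.
  by move: xm; rewrite xE /=; lia.
by exists a => //; rewrite xE; apply: divides_in_addr => //; apply: wedge_submonoid.
Qed.

Lemma wedge_small_atom e : 0 < e ->
  exists2 a, atoms wedge a & 0 < value a < e.
Proof.
move=> e0; have [|x x2 /andP [x0]] := @small_wedge_element (Num.min e 1).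
  by rewrite lt_min e0 ltr01.
rewrite lt_min => /andP [xe x1].
have [||a ata [t Mt xE]] := @wedge_atom_dvd_small x _ _ (ltW x1).
- by right; right.
- by move=> x00; move: x0; rewrite x00 value0 ltxx.
exists a => //; move: (ata).
move=> /(reduced_atoms _ wedge_submonoid wedge_reduced) [Ma a0 _].
rewrite wedge_value_gt0 //=; have := wedge_value_ge0 Mt.
by move: xe; rewrite xE valueD; lra.
Qed.

(** Subtracting an atom of value less than [value x - 1] stays in the region
    [v > 1]; in particular no element of that region is an atom. *)
Lemma wedge_atom_dvd_big x : 1 < value x ->
  exists a y, [/\ atoms wedge a, 1 < value y & x = a + y].
Proof.
move=> x1; have [|a ata /andP [a0 ax]] := @wedge_small_atom (value x - 1).
  by rewrite subr_gt0.
exists a, (x - a); have xE : x = a + (x - a) by rewrite addrC subrK.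
by split=> //; move: (valueD a (x - a)); rewrite -xE; lra.
Qed.

Lemma wedge_furstenberg : furstenberg wedge.
Proof.
move=> x; rewrite reduced_invertibles;
  [|exact: wedge_submonoid|exact: wedge_reduced] => -[Mx x0].
have [x1|x1] := leP (value x) 1; first exact: wedge_atom_dvd_small.
have [a [y [ata y1 xE]]] := wedge_atom_dvd_big x1.
by exists a => //; exists y => //; right; left.
Qed.

Lemma wedge_atom_snd_ge0 a : atoms wedge a -> 0 <= a.2.
Proof.
move=> /(reduced_atoms _ wedge_submonoid wedge_reduced) [Ma a0 aP].
have [a1|a1] := leP (value a) 1; first by case: (wedge_fst_gt0 Ma a0 a1).
have [b [y [atb y1 aE]]] := wedge_atom_dvd_big a1.
have /(reduced_atoms _ wedge_submonoid wedge_reduced) [Mb b0 _] := atb.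
have [|//|y0] := aP b y Mb _ aE; first by right; left.
by move: y1; rewrite y0 value0 ltr10.
Qed.

Lemma wedge_not_atomic : ~ atomic wedge.
Proof.
apply: (@not_atomic_atoms_sub _ _ [set x | 0 <= x.2] (0, -1)) => //.
- by apply/submonoidP; split=> // x y; apply: addr_ge0.
- exact: wedge_atom_snd_ge0.
- rewrite reduced_invertibles;
    [|exact: wedge_submonoid|exact: wedge_reduced].
  split=> //; right; left; have [lb _] := sqrt2_bounds.
  by rewrite /value /=; lra.
Qed.

Lemma wedge_atoms_infinite : infinite_set (atoms wedge).
Proof.
move=> /finite_seqP [s atE].
have sP a : (a \in s) <-> atoms wedge a by rewrite atE.
have [a /sP|e e0 eP] := @seq_lower_bound R _ value s.
  move=> /(reduced_atoms _ wedge_submonoid wedge_reduced) [Ma a0 _].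
  exact: wedge_value_gt0.
have [a /sP /eP ea /andP [_]] := wedge_small_atom e0.
by rewrite ltNge ea.
Qed.

End Wedge.

Theorem proposition5p1 (k : option nat) (hk : k <> Some 0%N) :
  exists M : set (int * int)%type,
    [/\ submonoid M, furstenberg M, ~ atomic M & has_card (atoms M) k].
Proof.
case: k hk => [n|] hk.
  have n0 : (0 < n)%N by rewrite lt0n; apply/eqP => n0; apply: hk; rewrite n0.
  exists (lexcone n); split.
  - exact: lexcone_submonoid.
  - exact: lexcone_furstenberg.
  - exact: lexcone_not_atomic.
  - exact: lexcone_atoms_card.
exists (wedge realalg); split.
- exact: wedge_submonoid.
- exact: wedge_furstenberg.
- exact: wedge_not_atomic.
- exact: wedge_atoms_infinite.
Qed.
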